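(* Let $p, c > 0$, $q < 1$, $a, k \in \mathbb{R}$ be constants and let $b \in C^1([0,1]^2)$ be a given function. Let $b_1$ be the unique number in $\left(-\frac{\pi}{2},\frac{\pi}{2}\right)$ satisfying $\left(\frac{\pi}{2}-b_1\right)\cot\left(\frac{\pi}{2}-b_1\right) = q$, and suppose that $p(\pi - 2b_1)^2 > 4a$. Consider the system $$\frac{\partial u_1}{\partial t}(t,z) - p\frac{\partial^2 u_1}{\partial z^2}(t,z) - a u_1(t,z) - \int_0^1 b(z,s)u_2(t,s)\,ds = 0 \quad\text{and}\quad \frac{\partial u_2}{\partial t}(t,z) + c\frac{\partial u_2}{\partial z}(t,z) = 0 \quad\text{for } (t,z)\in(0,+\infty)\times(0,1),$$ $$u_1(t,0) = \frac{\partial u_1}{\partial z}(t,1) - q u_1(t,1) = 0 \quad\text{and}\quad u_2(t,0) = k u_1(t,1) \quad\text{for } t\ge 0,$$ with initial conditions $u_1[0] = u_{1,0}$, $u_2[0] = u_{2,0}$. Moreover, suppose that $$|k|\max_{0\le z\le 1}\left(\frac{\sin(\omega+\theta)}{\sin(\omega z+\theta)}\int_0^1 |b(z,s)|\,ds\right) < p\omega^2 - a$$ for certain constants $\theta\in(0,\pi)$, $\omega\in[0,\pi-\theta)$ with $p\omega^2 > a$ and $\omega\cot(\omega+\theta) > q$. Then there exist constants $M,\delta>0$ such that for every $u_{1,0}, u_{2,0}\in C^1([0,1])$ with $u_{1,0}(0) = u_{1,0}'(1) - q u_{1,0}(1) = u_{2,0}(0) - k u_{1,0}(1) = 0$, for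 which there exists a unique pair of mappings $u_1\in C^0(\mathbb{R}_+\times[0,1])\cap C^1((0,+\infty)\times[0,1])$, $u_2\in C^1(\mathbb{R}_+\times[0,1])$ with $u_1[t]\in C^2([0,1])$ for $t>0$ satisfying the equations $\frac{\partial u_1}{\partial t}(t,z) - p\frac{\partial^2 u_1}{\partial z^2}(t,z) - a u_1(t,z) - \int_0^1 b(z,s)u_2(t,s)\,ds = 0$ and $\frac{\partial u_2}{\partial t}(t,z) + c\frac{\partial u_2}{\partial z}(t,z) = 0$ for $(t,z)\in(0,+\infty)\times(0,1)$, the boundary conditions $u_1(t,0) = \frac{\partial u_1}{\partial z}(t,1) - q u_1(t,1) = 0$ and $u_2(t,0) = k u_1(t,1)$ for $t\ge 0$, and the initial conditions $u_1[0] = u_{1,0}$, $u_2[0] = u_{2,0}$, the following inequality holds for all $t\ge 0$: $$\|u_1[t]\|_\infty + \|u_2[t]\|_\infty \le M\exp(-\delta t)\left(\|u_{1,0}\|_\infty + \|u_{2,0}\|_\infty\right).$$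
   Context: $\mathbb{R}_+ := [0,+\infty)$. All functions are real-valued. For $u : \mathbb{R}_+ \times [0,1] \to \mathbb{R}$, $u[t]$ denotes the profile at time $t\ge 0$, i.e. $(u[t])(z) = u(t,z)$ for $z\in[0,1]$. A prime denotes differentiation with respect to the spatial variable. $\|f\|_\infty$ is the (essential) supremum norm of $f$ on $[0,1]$. $C^k(U)$ denotes the functions on $U$ with continuous derivatives of order up to $k$ on $U$. *)

(* Defs.v *)
From HB Require Import structures.
From mathcomp Require Import all_boot all_order all_algebra.
From mathcomp Require Import all_classical all_reals all_analysis.
Set Implicit Arguments.
Unset Strict Implicit.
Unset Printing Implicit Defensive.
Import Order.TTheory GRing.Theory Num.Theory.
Import numFieldNormedType.Exports.
Local Open Scope classical_set_scope.
Local Open Scope ring_scope.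

(* A function on a subset of R (resp. of R^2) is encoded by a total function
   R -> R (resp. R -> R -> R) whose values off the subset are irrelevant.  The
   derivatives below are therefore taken relative to the subset D: two-sided at
   interior points of D (see deriv_on_interior), one-sided at the endpoints of
   an interval. *)
Section Regularity.
Context {R : realType}.
Implicit Types (D : set R) (U : set (R * R)).

Definition diffq_on D (f : R -> R) (x : R) :=
  (y - x)^-1 * (f y - f x) @[y --> within D x^'].

Definition derivable_on D (f : R -> R) (x : R) : Prop := cvg (diffq_on D f x).

Definition deriv_on D (f : R -> R) (x : R) : R := lim (diffq_on D f x).

Lemma diffq_on_interior D (f : R -> R) (x : R) : D° x ->
  diffq_on D f x = (h^-1 *: (f (h + x) - f x) @[h --> 0^']).
Proof.
rewrite /interior /= => Dx; apply/seteqP; split => P /= hP.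
- have {}hP : \forall y \near x,
      y != x -> D y -> P ((y - x)^-1 * (f y - f x)) by exact: hP.
  have {}hP : \forall y \near x, y != x -> P ((y - x)^-1 * (f y - f x)).
    by move: Dx hP; apply: filterS2 => y Dy + yx; apply.
  suff : \forall h \near (0 : R), h != 0 -> P (h^-1 *: (f (h + x) - f x)) by [].
  move: hP; rewrite (near_shift 0) subr0; apply: filterS => h /= hP h0.
  by have := hP; rewrite addrK -subr_eq0 addrK; apply.
- have {}hP : \forall h \near (0 : R),
      h != 0 -> P (h^-1 *: (f (h + x) - f x)) by exact: hP.
  suff : \forall y \near x, y != x -> D y -> P ((y - x)^-1 * (f y - f x)) by [].
  move: hP; rewrite (near_shift x) sub0r; apply: filterS => y /= hP yx _.
  by have := hP; rewrite subrK subr_eq0; apply.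
Qed.

Lemma deriv_on_interior D (f : R -> R) (x : R) :
  D° x -> deriv_on D f x = (f^`())%classic x.
Proof. by move=> Dx; rewrite /deriv_on diffq_on_interior. Qed.

Lemma derivable_on_interior D (f : R -> R) (x : R) :
  D° x -> derivable_on D f x <-> derivable f x 1.
Proof.
move=> Dx; rewrite /derivable_on diffq_on_interior// /derivable.
rewrite (_ : (fun h : R => h^-1 *: (f (h *: 1 + x) - f x)) =
  (fun h : R => h^-1 *: (f (h + x) - f x)))//.
by apply/funext => h; rewrite /GRing.scale /= mulr1.
Qed.

Fixpoint Ck_on (k : nat) D (f : R -> R) : Prop :=
  {within D, continuous f} /\
  if k is k'.+1 then
    (forall x, D x -> derivable_on D f x) /\ Ck_on k' D (deriv_on D f)
  else True.

Definition slice1 U (z : R) : set R := [set t | U (t, z)].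
Definition slice2 U (t : R) : set R := [set z | U (t, z)].

Fixpoint Ck_on2 (k : nat) U (f : R -> R -> R) : Prop :=
  {within U, continuous (fun x : R * R => f x.1 x.2)} /\
  if k is k'.+1 then
    [/\ forall t z, U (t, z) ->
          derivable_on (slice1 U z) (f^~ z) t /\
          derivable_on (slice2 U t) (f t) z,
        Ck_on2 k' U (fun t z => deriv_on (slice1 U z) (f^~ z) t) &
        Ck_on2 k' U (fun t z => deriv_on (slice2 U t) (f t) z)]
  else True.

(* Only applied to functions continuous on [0,1], for which the supremum is
   finite and equals the essential supremum. *)
Definition sup_norm (f : R -> R) : R := sup [set `|f z| | z in `[0, 1]].

Definition cot (x : R) : R := cos x / sin x.

End Regularity.

Section System.
Context {R : realType}.

Record is_solution (p c a k q : R) (b : R -> R -> R) (u10 u20 : R -> R)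
    (u1 u2 : R -> R -> R) : Prop := IsSolution {
  sol_u1_C0 : Ck_on2 0 (`[0, +oo[ `*` `[0, 1]) u1 ;
  sol_u1_C1 : Ck_on2 1 (`]0, +oo[ `*` `[0, 1]) u1 ;
  sol_u1_C2 : forall t, 0 < t -> Ck_on 2 `[0, 1] (u1 t) ;
  sol_u2_C1 : Ck_on2 1 (`[0, +oo[ `*` `[0, 1]) u2 ;
  sol_pde1 : forall t z, 0 < t -> 0 < z < 1 ->
    ((u1^~ z)^`())%classic t - p * ((u1 t)^`(2))%classic z - a * u1 t z
      - \int[lebesgue_measure]_(s in `[0, 1]) (b z s * u2 t s) = 0 ;
  sol_pde2 : forall t z, 0 < t -> 0 < z < 1 ->
    ((u2^~ z)^`())%classic t + c * ((u2 t)^`())%classic z = 0 ;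
  sol_bc1_0 : forall t, 0 <= t -> u1 t 0 = 0 ;
  sol_bc1_1 : forall t, 0 <= t -> deriv_on `[0, 1] (u1 t) 1 - q * u1 t 1 = 0 ;
  sol_bc2 : forall t, 0 <= t -> u2 t 0 = k * u1 t 1 ;
  sol_ic1 : forall z, 0 <= z <= 1 -> u1 0 z = u10 z ;
  sol_ic2 : forall z, 0 <= z <= 1 -> u2 0 z = u20 z
}.

(* Competing pairs need only coincide on [0,+oo) x [0,1], as values off that
   set are irrelevant. *)
Definition is_unique_solution (p c a k q : R) (b : R -> R -> R)
    (u10 u20 : R -> R) (u1 u2 : R -> R -> R) : Prop :=
  is_solution p c a k q b u10 u20 u1 u2 /\
  forall v1 v2, is_solution p c a k q b u10 u20 v1 v2 ->
    forall t z, 0 <= t -> 0 <= z <= 1 -> v1 t z = u1 t z /\ v2 t z = u2 t z.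

End System.

(* Main.v *)
Require Import Defs.
From mathcomp Require Import all_boot all_order all_algebra.
From mathcomp Require Import all_classical all_reals all_analysis.
From mathcomp Require Import ring lra.
Import Order.TTheory GRing.Theory Num.Theory.
Import numFieldNormedType.Exports.
Local Open Scope classical_set_scope.
Local Open Scope ring_scope.

(* A barrier argument.  With phi z = sin (omega z + theta), which is positive on
   [0, 1], one has phi'' = - omega^2 phi and, by the hypothesis on the
   cotangent, phi' 1 > q phi 1.  For a small rate d > 0 put
     psi1 = A e^(-d t) phi z,
     psi2 = (|k| phi 1 + d) A e^(2 d z / c - d t),
   with A large enough for the initial data to lie strictly below psi1, psi2.
   At a first time where |u1| = psi1 or |u2| = psi2, the maximum principle gives
   a contradiction: psi1 is a strict supersolution in the interior by the
   small-gain condition (perturbed by d) and at z = 1 by the Robin condition,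
   while psi2 is a strict supersolution of the transport equation and dominates
   |k| psi1 at the inflow.  The exponential weight in z replaces an integration
   along characteristics. *)

(** * Limit passages, touching conditions and the first touching time *)

Lemma cvg_frequently_le0 {R : realType} {T : Type} (F : set_system T)
    {FF : Filter F} (f : T -> R) (l : R) :
  f @ F --> l -> (forall P, F P -> exists2 y, P y & f y <= 0) -> l <= 0.
Proof.
move=> fl freq; rewrite leNgt; apply/negP => l0.
have [y fy] := freq _ (cvgr_gt _ fl _ l0).
by rewrite leNgt fy.
Qed.

(** This carries an inequality to a limit point. It serves twice: to extend the transport equation
    to the outflow boundary, and to extend a strict bound before the touching time to a weak bound
    at that time. *)
Lemma within_continuous_frequently_le0 {R : realType} {T : topologicalType}
    (U : set T) (f : T -> R) (x : T) :
  {within U, continuous f} -> U x ->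
  (forall P, nbhs x P -> exists y, [/\ U y, P y & f y <= 0]) -> f x <= 0.
Proof.
move=> /subspace_continuousP cf Ux freq.
apply: (cvg_frequently_le0 _ _ _ (cf x Ux)) => P UP.
have [y [Uy Py fy0]] := freq _ UP.
by exists y => //; exact: Py.
Qed.

Lemma is_derive_diffq_on {R : realType} (D : set R) (f : R -> R) (x d : R) :
  is_derive x 1 f d -> diffq_on D f x --> d.
Proof.
move=> [df <-].
have -> : 'D_1 f x = (f^`())%classic x by rewrite derive1E.
have h : diffq_on setT f x --> (f^`())%classic x.
  rewrite (@diffq_on_interior R setT f x); last by rewrite interiorT.
  have := df; rewrite /derivable /derive1.
  under eq_fun do rewrite /GRing.scale /= mulr1.
  done.
apply: cvg_trans h; apply: cvg_fmap2 => P TP.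
have {}TP : \forall y \near x^', setT y -> P y by exact: TP.
suff : \forall y \near x^', D y -> P y by [].
by apply: filterS TP => y /(_ I).
Qed.

Lemma diffq_on_comb {R : realType} (D : set R) (f g : R -> R) (s x l m : R) :
  diffq_on D f x --> l -> diffq_on D g x --> m ->
  diffq_on D (fun y => s * f y - g y) x --> s * l - m.
Proof.
move=> fl gm.
rewrite /diffq_on (_ : (fun y => _) = (fun y =>
    s * ((y - x)^-1 * (f y - f x)) - (y - x)^-1 * (g y - g x))).
  exact: cvgB (cvgM (cvg_cst s) fl) gm.
by apply/funext => y; ring.
Qed.

(* Only the values to the left of [x] matter: this serves both for time
   derivatives at a first touching time and at the right end [z = 1]. *)
Lemma touching_left {R : realType} (D : set R) (f g : R -> R) (s x l m : R) :
  (\forall y \near x^'-, D y) ->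
  diffq_on D f x --> l -> is_derive x 1 g m ->
  (forall y, D y -> y < x -> s * f y <= g y) -> s * f x = g x ->
  m <= s * l.
Proof.
move=> Dx fl /(is_derive_diffq_on D) gm sfg sfx.
have h := diffq_on_comb _ _ _ s _ _ _ fl gm.
rewrite -subr_ge0.
(* Since [D] holds just to the left of [x], the limit may be taken along [x^'-] alone. There [y - x]
   and the increment of [s * f - g] are both nonpositive, so the quotient is nonnegative. *)
have {}h : (y - x)^-1 * ((s * f y - g y) - (s * f x - g x)) @[y --> x^'-]
    --> s * l - m.
  apply: cvg_trans h; apply: cvg_fmap2 => P /= DP.
  have {}DP : \forall y \near x, y != x -> D y -> P y by exact: DP.
  apply: filterS2 Dx (_ : \forall y \near x^'-, D y -> P y).
    by move=> y Dy; exact.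
  rewrite near_withinE; apply: filterS DP => y + yx Dy; apply => //.
  by rewrite lt_eqF.
rewrite -(cvg_lim _ h)//.
apply: limr_ge; first exact: cvgP h.
apply: filterS2 Dx (nbhs_left_lt x) => y Dy yx.
rewrite sfx subrr subr0 mulr_le0 ?subr_le0 ?sfg//.
by rewrite invr_le0 subr_le0 ltW.
Qed.

(** At the maximum [dg x = 0]. The mean value theorem between [x] and a nearby [y > x] yields a
    point [c] with [dg c <= 0], so the difference quotients of [dg] at [x] are nonpositive at points
    arbitrarily close to [x], and hence so is their limit. *)
Lemma second_derivative_max {R : realType} (g dg : R -> R) (a b x d2 : R) :
  x \in `]a, b[ -> (forall y, y \in `]a, b[ -> is_derive y 1 g (dg y)) ->
  is_derive x 1 dg d2 -> (forall y, y \in `]a, b[ -> g y <= g x) -> d2 <= 0.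
Proof.
move=> xab gd dgd gmax.
have /andP[ax xb] : a < x < b by rewrite in_itv in xab.
have ab : a <= b by lra.
have dg0 : dg x = 0.
  have := derive1_at_max ab (fun y yab => @ex_derive _ _ _ _ _ _ _ (gd y yab)) xab gmax.
  by move=> [_ <-]; have [_ <-] := gd x xab.
have := is_derive_diffq_on setT dg x d2 dgd.
rewrite /diffq_on; move=> h.
apply: (cvg_frequently_le0 _ _ _ h) => P xP.
have {}xP : \forall y \near x, y != x -> setT y -> P y by exact: xP.
have [e /= e0 eP] := xP.
have [y /andP[xy yb] yxe] : exists2 y, x < y < b & y < x + e.
  exists (Num.min (x + e / 2) ((x + b) / 2));
  by case: (leP (x + e / 2) ((x + b) / 2)) => ?; lra.
have gd' z : z \in `]x, y[ -> is_derive z 1 g (dg z).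
  by rewrite in_itv/= => /andP[xz zy]; apply: gd; rewrite in_itv/=; lra.
have cg : {within `[x, y], continuous g}.
  apply: derivable_within_continuous => z; rewrite in_itv/= => /andP[xz zy].
  have zab : z \in `]a, b[ by rewrite in_itv/=; lra.
  exact: (@ex_derive _ _ _ _ _ _ _ (gd z zab)).
have [c cxy] := MVT xy gd' cg.
move: cxy; rewrite in_itv/= => /andP[xc cy] gyx.
exists c; last first.
  rewrite dg0 subr0 pmulr_rle0 ?invr_gt0; last by lra.
  rewrite -(@pmulr_lle0 _ (y - x)); last by lra.
  rewrite -gyx subr_le0; apply: gmax; rewrite in_itv/=; lra.
apply: eP => //; last by rewrite gt_eqF//; lra.
rewrite /ball/= ltr_norml; lra.
Qed.

Lemma is_derive_comb {R : realType} (f g : R -> R) (s x l m : R) :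
  is_derive x 1 f l -> is_derive x 1 g m ->
  is_derive x 1 (fun y => s * f y - g y) (s * l - m).
Proof.
by move=> fl gm; exact: (is_deriveB (is_deriveZ s fl) gm).
Qed.

(** The function [s * f - psi] has a maximum, equal to zero, at the interior point [x]. *)
Lemma touching_second {R : realType} (f df psi dpsi : R -> R)
    (s x d2f d2psi : R) :
  0 < x < 1 -> (forall y : R, 0 < y < 1 -> is_derive y 1 f (df y)) ->
  is_derive x 1 df d2f ->
  (forall y : R, is_derive y 1 psi (dpsi y)) -> is_derive x 1 dpsi d2psi ->
  (forall y : R, 0 <= y <= 1 -> s * f y <= psi y) -> s * f x = psi x ->
  s * d2f <= d2psi.
Proof.
move=> x01 fd dfd psid dpsid sf sfx.
rewrite -subr_le0.
have gd (y : R) : y \in `]0, 1[ ->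
    is_derive y 1 (fun y => s * f y - psi y) (s * df y - dpsi y).
  by rewrite in_itv/= => y01; have ? := fd y y01; exact: is_derive_comb.
have dgd : is_derive x 1 (fun y => s * df y - dpsi y) (s * d2f - d2psi).
  exact: is_derive_comb.
have xI : x \in `]0, 1[ by rewrite in_itv.
apply: (second_derivative_max _ _ _ _ _ _ xI gd dgd) => y.
by rewrite in_itv/= => /andP[y0 y1]; rewrite sfx subrr subr_le0 sf//; lra.
Qed.

(** The points of [K] with [0 <= h] form a nonempty compact set, on which the time coordinate
    attains its minimum. *)
Lemma first_time {R : realType} (h : R * R -> R) (T : R) :
  let K := `[0, T] `*` `[0, 1] in
  {within K, continuous h} -> (exists2 x, K x & 0 <= h x) ->
  exists tz, [/\ K tz, 0 <= h tz &
    forall sy, K sy -> sy.1 < tz.1 -> h sy < 0].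
Proof.
move=> K ch [x Kx hx].
have cK : compact K by apply: compact_setX; exact: segment_compact.
pose F := (h @^-1` [set r | 0 <= r]) `&` K.
have clK : closed K by apply: compact_closed => //; exact: norm_hausdorff.
have clF : closed F.
  rewrite /F (closed_setIS (h @^-1` [set r | 0 <= r]) clK).
  by apply: closed_comp; [move=> y _; exact: ch | exact: closed_ge].
have cF : compact F by apply: subclosed_compact clF cK _ => y [].
have [||[t z]] := @compact_EVT_min _ R fst F _ cF.
- by exists x.
- by apply: continuous_subspaceT => y; exact: cvg_fst.
rewrite inE => -[/= htz Ktz] tmin.
exists (t, z); split => // sy Ksy st.
rewrite ltNge; apply/negP => hsy.
have : t <= sy.1 by apply: (tmin sy); rewrite inE.
by rewrite leNgt st.
Qed.

(** * From relative derivatives to classical ones in the interior *)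

Lemma Ck_on2_derive_fst {R : realType} (U : set (R * R)) (f : R -> R -> R)
    (t z : R) :
  Ck_on2 1 U f -> (slice1 U z)° t ->
  is_derive t 1 (f^~ z) ((f^~ z)^`() t)%classic.
Proof.
move=> [_ [df _ _]] Ut; have [dt _] := df _ _ (interior_subset Ut).
split; last by rewrite derive1E.
exact: (derivable_on_interior (f^~ z) Ut).1 dt.
Qed.

Lemma unit_interval_interior {R : realType} (z : R) :
  0 < z < 1 -> (`[0, 1]%classic : set R)° z.
Proof. by move=> z01; rewrite interior_itv/= in_itv. Qed.

Lemma Ck2_is_derive_interior {R : realType} (f : R -> R) (z : R) :
  Ck_on 2 `[0, 1] f -> 0 < z < 1 ->
  is_derive z 1 f (f^`() z)%classic /\
  is_derive z 1 (f^`())%classic (f^`(2) z)%classic.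
Proof.
move=> [_ [df [_ [d2f _]]]] z01.
have z01' : `[0, 1]%classic z by rewrite /= in_itv/=; lra.
have zI := unit_interval_interior z z01.
split; split; last by rewrite derive1nS /= derive1E.
- exact: (derivable_on_interior f zI).1 (df z z01').
- by rewrite derive1E.
have dd : derivable (deriv_on `[0, 1] f) z 1.
  exact: (derivable_on_interior (deriv_on `[0, 1] f) zI).1 (d2f z z01').
have h : is_derive z 1 (deriv_on `[0, 1] f) ('D_1 (deriv_on `[0, 1] f) z) by [].
(* The relative and the classical first derivative are known to agree only at interior points. These
   form an open set, so they agree near [z], which is enough to differentiate once more. *)
apply: (@ex_derive _ _ _ _ _ _ _ (near_eq_is_derive _ h)).
have : \forall y \near z, (`[0, 1]%classic : set R)° y by apply: open_nbhs_nbhs; split => //; exact: open_interior.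
by apply: filterS => y /deriv_on_interior ->.
Qed.

Lemma within_continuous_slice {R : realType} (A B : set R) (f : R -> R -> R)
    (t : R) :
  {within A `*` B, continuous (fun x : R * R => f x.1 x.2)} -> A t ->
  {within B, continuous (f t)}.
Proof.
move=> /subspace_continuousP cf At; apply/subspace_continuousP => z Bz.
move=> P /(cf (t, z) (conj At Bz))[[P1 P2] /= [tP1 zP2] PP].
have : \forall y \near z, P2 y by [].
rewrite /within/=; apply: filterS => y P2y By.
by apply: (PP (t, y)) => //; split => //; exact: nbhs_singleton tP1.
Qed.

(** * Bounds by the supremum norm and for the integral term *)

Lemma le_sup_norm {R : realType} (f : R -> R) (z : R) :
  {within `[0, 1], continuous f} -> 0 <= z <= 1 -> `|f z| <= sup_norm f.
Proof.
move=> cf z01; apply: ub_le_sup; last by exists z; rewrite //= in_itv.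
have [|c c01 fc] := @EVT_max R (Num.norm \o f) 0 1 ler01.
  by move=> y; apply: cvg_norm; exact: cf.
by exists `|f c| => _ [y y01 <-]; exact: fc.
Qed.

Lemma sup_norm_le {R : realType} (f : R -> R) (C : R) :
  (forall z, 0 <= z <= 1 -> `|f z| <= C) -> sup_norm f <= C.
Proof.
move=> fC; apply: ge_sup.
  by exists `|f 0|, 0; rewrite //= in_itv/= lexx ler01.
by move=> _ [z + <-]; rewrite /= in_itv/=; exact: fC.
Qed.

Lemma norm_Rintegral_le {R : realType} (f u : R -> R) (C : R) :
  {within `[0, 1], continuous f} -> {within `[0, 1], continuous u} ->
  (forall s, 0 <= s <= 1 -> `|u s| <= C) ->
  `|\int[lebesgue_measure]_(s in `[0, 1]) (f s * u s)|
    <= C * \int[lebesgue_measure]_(s in `[0, 1]) `|f s|.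
Proof.
move=> cf cu uC.
have int (g : R -> R) : {within `[0, 1], continuous g} ->
    lebesgue_measure.-integrable `[0, 1] (EFin \o g).
  by move=> cg; apply: continuous_compact_integrable => //; exact: segment_compact.
have cn (g : R -> R) : {within `[0, 1], continuous g} ->
    {within `[0, 1], continuous (fun s : R => `|g s|)}.
  by move=> cg y; apply: cvg_norm; exact: cg.
have cM (g h : R -> R) : {within `[0, 1], continuous g} ->
    {within `[0, 1], continuous h} -> {within `[0, 1], continuous (fun s : R => g s * h s)}.
  by move=> cg ch y; exact: (cvgM (cg y) (ch y)).
have cc : {within `[0, 1], continuous (fun _ : R => C)} by move=> y; exact: cvg_cst.
apply: (le_trans (le_normr_Rintegral _ (int _ (cM _ _ cf cu)))) => //.
rewrite -RintegralZl//; last exact/int/cn.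
apply: le_Rintegral => //; [exact/int/cn/cM|exact/int/cM/cn|].
move=> s; rewrite /= in_itv/= => s01.
by rewrite normrM mulrC ler_wpM2r// uC.
Qed.

(** * The transport equation up to the outflow boundary *)

Lemma slice2_setX {R : realType} (A B : set R) (t : R) :
  A t -> slice2 (A `*` B) t = B.
Proof. by move=> At; apply/seteqP; split => z; rewrite /slice2/=; [case|]. Qed.

(* The transport equation is assumed in the open strip only; continuity of the
   derivatives extends it to the outflow boundary. *)
Lemma transport_closed {R : realType} (c : R) (u : R -> R -> R) (t z : R) :
  Ck_on2 1 (`[0, +oo[ `*` `[0, 1]) u ->
  (forall z, 0 < z < 1 -> (u^~ z)^`()%classic t + c * (u t)^`()%classic z = 0) ->
  0 < t -> 0 < z <= 1 ->
  diffq_on `[0, 1] (u t) z --> deriv_on `[0, 1] (u t) z /\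
  (u^~ z)^`()%classic t + c * deriv_on `[0, 1] (u t) z = 0.
Proof.
set U := _ `*` _ => Cu pde t0 /andP[z0 z1].
have It y : 0 <= y <= 1 -> (slice1 U y)° t.
  move=> y01; apply: filterS (lt_nbhsr t0) => s s0.
  by rewrite /slice1 /U /= !in_itv/= (ltW s0).
have tU : `[0, +oo[%classic t by rewrite /= in_itv/= ltW.
have U2 : slice2 U t = `[0, 1]%classic by rewrite slice2_setX.
have Utz y : 0 <= y <= 1 -> U (t, y) by move=> y01; rewrite /U /= in_itv.
have [_ [du [cut _] [cuz _]]] := Cu.
have z01 : 0 <= z <= 1 by rewrite ltW.
split; first by have [_] := du t z (Utz z z01); rewrite U2.
(* [G] is the left side of the transport equation written with derivatives relative to [U], for
   which [Ck_on2] provides continuity up to the boundary. *)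
pose G (x : R * R) := deriv_on (slice1 U x.2) (u^~ x.2) x.1
  + c * deriv_on (slice2 U x.1) (u x.1) x.2.
have GE y : 0 <= y <= 1 ->
    G (t, y) = (u^~ y)^`()%classic t + c * deriv_on `[0, 1] (u t) y.
  by move=> y01; rewrite /G /= U2 deriv_on_interior //; exact: It.
have G0 y : 0 < y < 1 -> G (t, y) = 0.
  move=> y01; rewrite GE; last by lra.
  by rewrite (deriv_on_interior _ (unit_interval_interior y y01)) pde.
have cG : {within U, continuous G}.
  move=> x; apply: cvgD; first exact: cut.
  by apply: cvgM; [exact: cvg_cst | exact: cuz].
(* The point [(t, z)] is approached at fixed time by interior points [(t, y)] with [y < z], where
   [G] vanishes. Applying the limit passage to [G] and to [- G] gives both inequalities. *)
have freq P : nbhs (t, z) P -> exists y, [/\ U (t, y), P (t, y) & 0 < y < 1].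
  move=> [[P1 P2] /= [tP1 zP2] PP].
  have [y [P2y yz y0]] : exists y, [/\ P2 y, y < z & 0 < y].
    have zP2' : \forall y \near z^'-, P2 y.
      by rewrite near_withinE; apply: filterS zP2.
    have : \forall y \near z^'-, [/\ P2 y, y < z & 0 < y].
      by apply: filterS3 zP2' (nbhs_left_lt z) (nbhs_left_gt z0).
    move=> h; have [y [P2y yz y0]] := @filter_ex _ _ (at_left_proper_filter z) _ h.
    by exists y.
  exists y; split; [apply: Utz; lra | | lra].
  by apply: (PP (t, y)); split => //=; exact: nbhs_singleton tP1.
rewrite -GE//; apply/eqP; rewrite eq_le -oppr_le0; apply/andP; split.
- apply: (within_continuous_frequently_le0 U G (t, z) cG (Utz z z01)).
  by move=> P /freq[y [Uy Py y01]]; exists (t, y); rewrite G0.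
- have cNG : {within U, continuous (fun x => - G x)}.
    by move=> x; apply: cvgN; exact: cG.
  apply: (within_continuous_frequently_le0 U (fun x => - G x) (t, z) cNG (Utz z z01)).
  by move=> P /freq[y [Uy Py y01]]; exists (t, y); rewrite G0// oppr0.
Qed.

(** The sign [s] is fixed at a touching point and then kept. Thus [s * u] touches the barrier
    wherever [|u|] does and stays below it elsewhere, and unlike [|u|] it is differentiable. The
    same [s] also bounds the integral term by its absolute value. *)
Lemma normr_sign_witness {R : realDomainType} (x : R) :
  exists2 s : R, s * x = `|x| & forall y, s * y <= `|y|.
Proof.
case: (leP 0 x) => x0.
- exists 1; first by rewrite mul1r ger0_norm.
  by move=> y; rewrite mul1r ler_norm.
- exists (-1); first by rewrite mulN1r ltr0_norm.
  by move=> y; rewrite mulN1r -normrN ler_norm.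
Qed.

(** * The explicit barriers and their derivatives *)

Section barriers.
Context {R : realType}.
Context (A B d c omega theta : R).

Definition barrier1 (t z : R) : R := A * expR (- d * t) * sin (omega * z + theta).
(** A spatial rate [d / c] would solve the transport equation exactly. Doubling it leaves the
    strictly positive surplus [d * barrier2]. *)
Definition barrier2 (t z : R) : R := B * expR (2 * d / c * z - d * t).

Lemma barrier1_dt (t z : R) :
  is_derive t 1 (barrier1^~ z) (- d * barrier1 t z).
Proof.
rewrite /barrier1; apply: is_derive_eq.
by rewrite /GRing.scale /=; ring.
Qed.

Lemma barrier1_dz (t z : R) :
  is_derive z 1 (barrier1 t)
    (A * expR (- d * t) * (omega * cos (omega * z + theta))).
Proof.
rewrite /barrier1; apply: is_derive_eq.
by rewrite /GRing.scale /=; ring.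
Qed.

Lemma barrier1_dzz (t z : R) :
  is_derive z 1
    (fun z => A * expR (- d * t) * (omega * cos (omega * z + theta)))
    (- omega ^+ 2 * barrier1 t z).
Proof.
rewrite /barrier1; apply: is_derive_eq.
by rewrite /GRing.scale /=; ring.
Qed.

Lemma barrier2_dt (t z : R) :
  is_derive t 1 (barrier2^~ z) (- d * barrier2 t z).
Proof.
rewrite /barrier2; apply: is_derive_eq.
by rewrite /GRing.scale /=; ring.
Qed.

Lemma barrier2_dz (t z : R) :
  is_derive z 1 (barrier2 t) (2 * d / c * barrier2 t z).
Proof.
rewrite /barrier2; apply: is_derive_eq.
by rewrite /GRing.scale /=; ring.
Qed.

Lemma barrier1_continuous : continuous (fun x : R * R => barrier1 x.1 x.2).
Proof.
move=> x; apply: cvgM; first apply: cvgM.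
- exact: cvg_cst.
- apply: continuous_comp; last exact: continuous_expR.
  by apply: cvgM; [exact: cvg_cst | exact: cvg_fst].
- apply: (@continuous_comp _ _ _ (fun x : R * R => omega * x.2 + theta));
    last exact: continuous_sin.
  apply: cvgD; last exact: cvg_cst.
  by apply: cvgM; [exact: cvg_cst | exact: cvg_snd].
Qed.

Lemma barrier2_continuous : continuous (fun x : R * R => barrier2 x.1 x.2).
Proof.
move=> x; apply: cvgM; first exact: cvg_cst.
apply: (@continuous_comp _ _ _ (fun x : R * R => 2 * d / c * x.2 - d * x.1));
  last exact: continuous_expR.
by apply: cvgB; apply: cvgM;
  [exact: cvg_cst | exact: cvg_snd | exact: cvg_cst | exact: cvg_fst].
Qed.

End barriers.

(** * Comparison of a solution with the barriers *)

Lemma near_left_itv {R : realType} (z : R) :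
  0 < z <= 1 -> \forall y \near z^'-, `[0, 1]%classic y.
Proof.
move=> /andP[z0 z1]; apply: filterS2 (nbhs_left_gt z0) (nbhs_left_lt z).
by move=> y y0 yz; rewrite /= in_itv/=; lra.
Qed.

Lemma near_left_ray {R : realType} (t : R) :
  0 < t -> \forall y \near t^'-, `]0, +oo[%classic y.
Proof.
by move=> t0; apply: filterS (nbhs_left_gt t0) => y y0; rewrite /= in_itv/= y0.
Qed.

Section stability.
Context {R : realType}.
Context (p c a k q : R) (b : R -> R -> R) (u10 u20 : R -> R).
Context (u1 u2 : R -> R -> R) (A d omega theta : R).
Context (hp : 0 < p) (hc : 0 < c) (A0 : 0 < A) (d0 : 0 < d).
Context (sol : is_solution p c a k q b u10 u20 u1 u2).
Context (cb : forall z : R, 0 <= z <= 1 -> {within `[0, 1], continuous (b z)}).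
Context (sin_gt0 : forall z : R, 0 <= z <= 1 -> 0 < sin (omega * z + theta)).
Context (robin : q * sin (omega + theta) < omega * cos (omega + theta)).
(** The summand [d] makes the second barrier exceed [|k|] times the first strictly at the inflow,
    even if [k = 0]. *)
Let gain := `|k| * sin (omega + theta) + d.
Context (small_gain : forall z : R, 0 < z < 1 ->
  gain * expR (2 * d / c) * (\int[lebesgue_measure]_(s in `[0, 1]) `|b z s|)
    < (p * omega ^+ 2 - a - d) * sin (omega * z + theta)).
Let psi1 := barrier1 A d omega theta.
Let psi2 := barrier2 (gain * A) d c.

Let gain_gt0 : 0 < gain.
Proof.
rewrite /gain ltr_wpDl// mulr_ge0// ltW//.
by rewrite -[omega]mulr1 sin_gt0// ler01 lexx.
Qed.

Let psi1_gt0 (t z : R) : 0 <= z <= 1 -> 0 < psi1 t z.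
Proof. by move=> z01; rewrite /psi1 /barrier1 !mulr_gt0 ?expR_gt0 ?sin_gt0. Qed.

Let psi2_gt0 (t z : R) : 0 < psi2 t z.
Proof. by rewrite /psi2 /barrier2 !mulr_gt0 ?expR_gt0. Qed.

Let cu2 (t : R) : 0 <= t -> {within `[0, 1], continuous (u2 t)}.
Proof.
move=> t0; apply: (within_continuous_slice `[0, +oo[) (sol_u2_C1 sol).1 _.
by rewrite /= in_itv/= t0.
Qed.

(** Three cases. At [z = 0] the solution vanishes while [psi1] is positive. At [z = 1] touching from
    the left bounds the slope of [s * u1] below by that of [psi1], against [robin]. In the interior,
    the first-order condition in time and the second-order condition in space contradict the
    equation through [small_gain]. *)
Lemma heat_no_touch (t z : R) : 0 < t -> 0 <= z <= 1 ->
  (forall s y : R, 0 < s <= t -> 0 <= y <= 1 -> `|u1 s y| <= psi1 s y) ->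
  (forall y : R, 0 <= y <= 1 -> `|u2 t y| <= psi2 t y) ->
  `|u1 t z| != psi1 t z.
Proof.
move=> t0 z01 le1 le2; apply/eqP => touch.
have tt : 0 < t <= t by rewrite t0 lexx.
have [s su sle] := normr_sign_witness (u1 t z).
have sle1 r y : 0 < r <= t -> 0 <= y <= 1 -> s * u1 r y <= psi1 r y.
  by move=> rt y01; apply: le_trans (sle _) (le1 _ _ rt y01).
have {touch}su : s * u1 t z = psi1 t z by rewrite su.
have psi0 := psi1_gt0 t z z01.
have /andP[z0 z1] := z01.
have [zE|zn0] := eqVneq z 0.
  by move: su psi0; rewrite zE (sol_bc1_0 sol (ltW t0)) mulr0 => <-; rewrite ltxx.
have {zn0}z0 : 0 < z by rewrite lt_neqAle eq_sym zn0.
have [zE|zn1] := eqVneq z 1.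
  have du : diffq_on `[0, 1] (u1 t) 1 --> deriv_on `[0, 1] (u1 t) 1.
    have [_ [du _]] := sol_u1_C2 sol t0.
    by apply: du; rewrite /= in_itv/= lexx ler01.
  have z01' : 0 < (1 : R) <= 1 by rewrite ltr01 lexx.
  rewrite zE in su.
  have le : A * expR (- d * t) * (omega * cos (omega * 1 + theta))
      <= s * deriv_on `[0, 1] (u1 t) 1.
    apply: (touching_left _ _ _ _ _ _ _ (near_left_itv 1 z01') du
      (barrier1_dz A d omega theta t 1) _ su) => y.
    by rewrite /= in_itv/= => y01 _; exact: sle1.
  have qu : deriv_on `[0, 1] (u1 t) 1 = q * u1 t 1.
    by apply/eqP; rewrite -subr_eq0 (sol_bc1_1 sol (ltW t0)).
  move: le; rewrite qu [s * _]mulrCA su leNgt => /negP; apply.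
  rewrite /psi1 /barrier1 mulrCA ltr_pM2l ?mulr_gt0 ?expR_gt0//.
  by rewrite mulr1.
have {zn1}z1 : z < 1 by rewrite lt_neqAle zn1.
have z01' : 0 < z < 1 by rewrite z0.
have dz y := fun y01 : 0 < y < 1 => (Ck2_is_derive_interior (u1 t) y (sol_u1_C2 sol t0) y01).1.
have dzz := (Ck2_is_derive_interior (u1 t) z (sol_u1_C2 sol t0) z01').2.
have h2 := touching_second _ _ _ _ s z _ _ z01' dz dzz
  (barrier1_dz A d omega theta t) (barrier1_dzz A d omega theta t z)
  (fun y => sle1 t y tt) su.
have It : (slice1 (`]0, +oo[ `*` `[0, 1]) z)° t.
  apply: filterS (lt_nbhsr t0) => r r0.
  by rewrite /slice1 /= !in_itv/= r0.
(* The open ray restricts the comparison to positive times, the only ones covered by [le1]. *)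
have dt := is_derive_diffq_on `]0, +oo[ _ _ _ (Ck_on2_derive_fst _ _ _ _ (sol_u1_C1 sol) It).
have h1 : - d * psi1 t z <= s * (u1^~ z)^`()%classic t.
  apply: (touching_left _ _ _ _ _ _ _ (near_left_ray t t0) dt
    (barrier1_dt A d omega theta t z) _ su) => r.
  by rewrite /= in_itv/= andbT => r0 rt; apply: sle1 => //; rewrite r0 ltW.
have pde := sol_pde1 sol t0 z01'.
set J := \int[_]_(_ in _) _ in pde.
(* The profile of [psi2] increases in [z], so its value at [z = 1] bounds [u2] throughout the
   integral. *)
have hJ : `|J| <= gain * A * expR (2 * d / c - d * t)
    * \int[lebesgue_measure]_(r in `[0, 1]) `|b z r|.
  apply: norm_Rintegral_le; [exact: cb|exact/cu2/ltW|].
  move=> r r01; apply: le_trans (le2 r r01) _.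
  rewrite /psi2 /barrier2 ler_pM2l ?mulr_gt0// ler_expR lerD2r.
  by rewrite ger_pMr ?divr_gt0 ?mulr_gt0//; case/andP: r01.
have sJ := sle J.
have AE0 : 0 < A * expR (- d * t) by rewrite mulr_gt0 ?expR_gt0.
have := small_gain z z01'; rewrite -(ltr_pM2l AE0).
move: pde hJ h1 h2 su; rewrite /psi1 /barrier1 expRD (mulNr d t).
set I := \int[_]_(_ in _) _; set E := expR (- (d * t)); set F := expR (_ / c).
set phi := sin _; set ut := _^`()%classic t; set uzz := _^`(_)%classic z.
move=> pde hJ h1 h2 su hg.
(* With [h1], [hp2] and [sJ] this equation yields [(p * omega ^+ 2 - a - d) * psi1 t z <= |J|],
   which [hJ] and [hg] exclude. *)
have e : s * ut = p * (s * uzz) + a * (s * u1 t z) + s * J.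
  have -> : ut = p * uzz + a * u1 t z + J by lra.
  by ring.
have hp2 := ler_wpM2l (ltW hp) h2.
rewrite su in e.
lra.
Qed.

(** At the inflow the term [d * A * expR (- (d * t))] separates [psi2] from [|k| * psi1]. Elsewhere,
    [z = 1] included, touching from the left in both variables gives
    [s * (ut + c * uz) >= d * psi2 > 0], against the equation. *)
Lemma transport_no_touch (t z : R) : 0 < t -> 0 <= z <= 1 ->
  (forall y : R, 0 <= y <= 1 -> `|u1 t y| <= psi1 t y) ->
  (forall s y : R, 0 < s <= t -> 0 <= y <= 1 -> `|u2 s y| <= psi2 s y) ->
  `|u2 t z| != psi2 t z.
Proof.
move=> t0 z01 le1 le2; apply/eqP => touch.
have tt : 0 < t <= t by rewrite t0 lexx.
have [s su sle] := normr_sign_witness (u2 t z).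
have sle2 r y : 0 < r <= t -> 0 <= y <= 1 -> s * u2 r y <= psi2 r y.
  by move=> rt y01; apply: le_trans (sle _) (le2 _ _ rt y01).
have psi0 := psi2_gt0 t z.
have /andP[z0 z1] := z01.
have [zE|zn0] := eqVneq z 0.
  move: touch; rewrite zE (sol_bc2 sol (ltW t0)) normrM => touch.
  have := ler_wpM2l (normr_ge0 k) (le1 1 _).
  rewrite ler01 lexx touch => /(_ erefl).
  rewrite /psi1 /psi2 /barrier1 /barrier2 mulr0 sub0r mulr1 (mulNr d t) /gain.
  have := mulr_gt0 (mulr_gt0 d0 A0) (expR_gt0 (- (d * t))).
  by lra.
have {}z0 : 0 < z <= 1 by rewrite lt_neqAle eq_sym zn0 z0.
have {touch}su : s * u2 t z = psi2 t z by rewrite su.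
have [dz pde] := transport_closed c u2 t z (sol_u2_C1 sol)
  (fun y => sol_pde2 sol t0) t0 z0.
have It : (slice1 (`[0, +oo[ `*` `[0, 1]) z)° t.
  apply: filterS (lt_nbhsr t0) => r r0.
  by rewrite /slice1 /= !in_itv/= (ltW r0).
have dt := is_derive_diffq_on `]0, +oo[ _ _ _ (Ck_on2_derive_fst _ _ _ _ (sol_u2_C1 sol) It).
have h1 : - d * psi2 t z <= s * (u2^~ z)^`()%classic t.
  apply: (touching_left _ _ _ _ _ _ _ (near_left_ray t t0) dt
    (barrier2_dt _ d c t z) _ su) => r.
  by rewrite /= in_itv/= andbT => r0 rt; apply: sle2 => //; rewrite r0 ltW.
have h2 : 2 * d / c * psi2 t z <= s * deriv_on `[0, 1] (u2 t) z.
  apply: (touching_left _ _ _ _ _ _ _ (near_left_itv z z0) dz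
    (barrier2_dz _ d c t z) _ su) => y.
  by rewrite /= in_itv/= => y01 _; exact: sle2.
have := ler_wpM2l (ltW hc) h2.
have -> : c * (2 * d / c * psi2 t z) = 2 * d * psi2 t z.
  by field; rewrite gt_eqF.
have := mulr_gt0 d0 psi0.
move: (congr1 (fun x => s * x) pde); rewrite mulr0 mulrDr.
move: h1; set ut := _^`()%classic t; set uz := deriv_on _ _ _; set P := psi2 t z.
lra.
Qed.

(** If the bound fails somewhere, there is a first time at which it fails. Up to that time both
    bounds hold weakly, so neither component can touch its barrier. *)
Lemma barrier_bound :
  (forall z : R, 0 <= z <= 1 -> `|u10 z| < A * sin (omega * z + theta)) ->
  (forall z : R, 0 <= z <= 1 -> `|u20 z| < gain * A) ->
  forall t z : R, 0 <= t -> 0 <= z <= 1 ->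
    `|u1 t z| < psi1 t z /\ `|u2 t z| < psi2 t z.
Proof.
move=> init1 init2 T z T0 z01; apply: contrapT => bad.
pose h (x : R * R) := Num.max (`|u1 x.1 x.2| - psi1 x.1 x.2)
  (`|u2 x.1 x.2| - psi2 x.1 x.2).
have hlt0 x : (h x < 0) = (`|u1 x.1 x.2| < psi1 x.1 x.2)
    && (`|u2 x.1 x.2| < psi2 x.1 x.2).
  by rewrite /h gt_max !subr_lt0.
have hle0 x : (h x <= 0) = (`|u1 x.1 x.2| <= psi1 x.1 x.2)
    && (`|u2 x.1 x.2| <= psi2 x.1 x.2).
  by rewrite /h ge_max !subr_le0.
pose K := (`[0, T] `*` `[0, 1] : set (R * R)).
have subK : K `<=` `[0, +oo[ `*` `[0, 1].
  by move=> [s y] []; rewrite /= !in_itv/= andbT => /andP[-> _].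
have ch : {within K, continuous h}.
  have c1 := continuous_subspaceW subK (sol_u1_C0 sol).1.
  have c2 := continuous_subspaceW subK (sol_u2_C1 sol).1.
  have cp1 : {within K, continuous (fun x : R * R => psi1 x.1 x.2)}.
    exact: continuous_subspaceT (barrier1_continuous _ _ _ _).
  have cp2 : {within K, continuous (fun x : R * R => psi2 x.1 x.2)}.
    exact: continuous_subspaceT (barrier2_continuous _ _ _).
  move=> x; apply: (@continuous_max _ (subspace K)).
  - by apply: cvgB; [apply: cvg_norm; exact: c1 | exact: cp1].
  - by apply: cvgB; [apply: cvg_norm; exact: c2 | exact: cp2].
have KTz : K (T, z) by rewrite /K /= !in_itv/= T0 lexx.
have [|[t y] [[/= Kt Ky] hty before]] := first_time h T ch.
  exists (T, z) => //; rewrite leNgt hlt0; apply/negP => /andP[? ?].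
  exact: bad.
move: Kt Ky; rewrite !in_itv/= => /andP[t0 tT] y01.
(* Time zero is excluded by the strict initial bounds, because the spatial weight in [psi2] is at
   least one. *)
have {}t0 : 0 < t.
  rewrite lt_neqAle t0 andbT eq_sym; apply/eqP => tE.
  have e1 : 1 <= expR (2 * d / c * y).
    have /andP[y0 _] := y01.
    by rewrite -[leLHS]expR0 ler_expR mulr_ge0// ltW// divr_gt0// mulr_gt0.
  have lt2 : `|u20 y| < gain * A * expR (2 * d / c * y).
    by apply: (lt_le_trans (init2 _ y01)); rewrite ler_peMr// ltW// mulr_gt0.
  move: hty; rewrite leNgt hlt0 /= tE (sol_ic1 sol y01) (sol_ic2 sol y01).
  rewrite /psi1 /psi2 /barrier1 /barrier2 !mulr0 expR0 mulr1 subr0.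
  by rewrite init1// lt2.
(* [before] concerns only times earlier than [t]. Letting times increase to [s] gives the weak
   inequality also at [s = t]. *)
have le s x : 0 < s <= t -> 0 <= x <= 1 -> h (s, x) <= 0.
  move=> /andP[s0 st] x01.
  apply: (within_continuous_frequently_le0 K h) => //.
    by rewrite /K /= !in_itv/= (ltW s0) (le_trans st).
  move=> P [[P1 P2] /= [sP1 xP2] PP].
  have sP1' : \forall r \near s^'-, P1 r.
    by rewrite near_withinE; apply: filterS sP1.
  have : \forall r \near s^'-, [/\ P1 r, r < s & 0 < r].
    by apply: filterS3 sP1' (nbhs_left_lt s) (nbhs_left_gt s0).
  move=> nr; have [r [P1r rs r0]] := @filter_ex _ _ (at_left_proper_filter s) _ nr.
  have Krx : K (r, x) by rewrite /K /= !in_itv/= (ltW r0) /=; split => //; lra.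
  exists (r, x); split => //.
    by apply: PP; split => //=; exact: nbhs_singleton xP2.
  by apply/ltW/before => //=; lra.
have tt : 0 < t <= t by rewrite t0 lexx.
have le1 s x : 0 < s <= t -> 0 <= x <= 1 -> `|u1 s x| <= psi1 s x.
  by move=> st x01; have := le s x st x01; rewrite hle0 => /andP[].
have le2 s x : 0 < s <= t -> 0 <= x <= 1 -> `|u2 s x| <= psi2 s x.
  by move=> st x01; have := le s x st x01; rewrite hle0 => /andP[].
have n1 := heat_no_touch t y t0 y01 le1 (fun x => le2 t x tt).
have n2 := transport_no_touch t y t0 y01 (fun x => le1 t x tt) le2.
move: hty; rewrite leNgt hlt0 /= !lt_neqAle n1 n2 le1// le2//.
Qed.

End stability.


(** * Choice of the constants and the decay estimate *)

Lemma continuous_lt_right {R : realType} (f : R -> R) (C : R) :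
  {for 0, continuous f} -> f 0 < C -> exists2 d : R, 0 < d & f d < C.
Proof.
move=> cf f0.
have f0C : \forall d \near (0 : R), f d < C by exact: (cvgr_lt _ cf _ f0).
have : \forall d \near 0^'+, 0 < d /\ f d < C.
  rewrite near_withinE; apply: filterS f0C => d fd d0.
  by split.
move=> h; have [d [d0 fd]] := @filter_ex _ _ (at_right_proper_filter 0) _ h.
by exists d.
Qed.

Theorem theorem2p6 (R : realType) (p c q a k : R) (b : R -> R -> R)
  (b1 theta omega : R)
  (hp : 0 < p) (hc : 0 < c) (hq : q < 1)
  (hb : Ck_on2 1 (`[0, 1] `*` `[0, 1]) b)
  (hb1_range : - (pi / 2) < b1 < pi / 2)
  (hb1 : (pi / 2 - b1) * cot (pi / 2 - b1) = q)
  (hstab : 4 * a < p * (pi - 2 * b1) ^+ 2)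
  (htheta : 0 < theta < pi)
  (homega : 0 <= omega < pi - theta)
  (hpa : a < p * omega ^+ 2)
  (hcot : q < omega * cot (omega + theta))
  (hgain :
    `|k| * sup [set sin (omega + theta) / sin (omega * z + theta)
                    * \int[lebesgue_measure]_(s in `[0, 1]) `|b z s|
               | z in `[0, 1]]
    < p * omega ^+ 2 - a) :
  exists M delta : R, [/\ 0 < M, 0 < delta &
    forall u10 u20 : R -> R,
      Ck_on 1 `[0, 1] u10 -> Ck_on 1 `[0, 1] u20 ->
      u10 0 = 0 ->
      deriv_on `[0, 1] u10 1 - q * u10 1 = 0 ->
      u20 0 - k * u10 1 = 0 ->
    forall u1 u2 : R -> R -> R,
      is_unique_solution p c a k q b u10 u20 u1 u2 ->
    forall t : R, 0 <= t ->
      sup_norm (u1 t) + sup_norm (u2 t)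
        <= M * expR (- delta * t) * (sup_norm u10 + sup_norm u20)].
Proof.
have sin_pos z : 0 <= z <= 1 -> 0 < sin (omega * z + theta).
  move=> /andP[z0 z1]; apply: sin_gt0_pi; case/andP: homega => w0 w1.
  case/andP: htheta => th0 _; have := mulr_ge0 w0 z0.
  by have := ler_piMr w0 z1; lra.
have s1 : 0 < sin (omega + theta).
  by rewrite -[omega]mulr1 sin_pos// ler01 lexx.
have robin : q * sin (omega + theta) < omega * cos (omega + theta).
  by move: hcot; rewrite /cot mulrA ltr_pdivlMr.
have cb z : 0 <= z <= 1 -> {within `[0, 1], continuous (b z)}.
  by move=> z01; apply: (within_continuous_slice `[0, 1] _ _ _ hb.1); rewrite /= in_itv.
(* A positive lower bound for the sine profile, needed to place the initial data below a multiple of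
   it. *)
have [m m0 mE] : exists2 m : R, 0 < m &
    forall z, 0 <= z <= 1 -> m <= sin (omega * z + theta).
  have [|z z01 zE] := @EVT_min R (fun z => sin (omega * z + theta)) 0 1 ler01.
    apply: continuous_subspaceT => z.
    apply: (@continuous_comp _ _ _ (fun z : R => omega * z + theta));
      last exact: continuous_sin.
    by apply: cvgD; [apply: cvgM; [exact: cvg_cst|exact: cvg_id]|exact: cvg_cst].
  exists (sin (omega * z + theta)); first by apply: sin_pos; rewrite in_itv in z01.
  by move=> y y01; apply: zE; rewrite in_itv.
pose I z := \int[lebesgue_measure]_(s in `[0, 1]) `|b z s|.
(* The constant [g] has two uses: it shows that the set whose supremum enters [hgain] is bounded
   above, and it controls the perturbation [d * I z]. *)
have [g g0 gE] : exists2 g : R, 0 <= g &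
    forall z, 0 <= z <= 1 -> I z <= g * sin (omega * z + theta).
  pose K := (`[0, 1] `*` `[0, 1] : set (R * R)).
  have cK : compact K by apply: compact_setX; exact: segment_compact.
  have cbn : {within K, continuous (fun x : R * R => `|b x.1 x.2|)}.
    by move=> x; apply: cvg_norm; exact: hb.1.
  have [|x _ xE] := compact_EVT_max _ cK cbn.
    by exists (0, 0); rewrite /K /= in_itv/= lexx ler01.
  exists (`|b x.1 x.2| / m); first by rewrite divr_ge0// ltW.
  move=> z z01.
  have Ib : I z <= `|b x.1 x.2|.
    have c1 : {within `[0, 1], continuous (fun _ : R => 1 : R)}.
      by move=> y; exact: cvg_cst.
    have cbz : {within `[0, 1], continuous (fun s : R => `|b z s|)}.
      by move=> y; apply: cvg_norm; exact: cb.
    have := norm_Rintegral_le _ _ `|b x.1 x.2| c1 cbz _.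
    rewrite /I; under eq_Rintegral do rewrite mul1r.
    move=> /(_ _)/(le_trans (ler_norm _)) -/(_ _)/le_trans; apply.
      by move=> s s01; rewrite normr_id; apply: (xE (z, s)); rewrite inE /K /= !in_itv.
    under eq_Rintegral do rewrite normr1.
    have mu01 : (@lebesgue_measure R) `[0, 1]%classic = 1%E.
      by rewrite lebesgue_measure_itv/= lte_fin ltr01 -EFinD subr0.
    by rewrite Rintegral_cst// (_ : fine _ = 1) ?mulr1//; exact: (congr1 fine mu01).
  apply: (le_trans Ib); rewrite -mulrA ler_peMr// ler_pdivlMl// mulr1.
  exact: mE.
set S := sup _ in hgain.
have SE z : 0 <= z <= 1 -> sin (omega + theta) * I z <= S * sin (omega * z + theta).
  move=> z01; rewrite -ler_pdivrMr ?sin_pos//.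
  apply: ub_le_sup; last by exists z; rewrite /= ?in_itv// /I mulrAC.
  exists (sin (omega + theta) * g) => _ [y + <-]; rewrite /= in_itv/= => y01.
  rewrite -mulrA ler_pM2l// mulrC ler_pdivrMr ?sin_pos//.
  exact: gE.
(* At [d = 0] the left side equals [|k| * S], so [hgain] and continuity leave room for a positive
   [d]. *)
have [d d0 dE] : exists2 d : R, 0 < d &
    expR (2 * d / c) * (`|k| * S + d * g) + d < p * omega ^+ 2 - a.
  apply: (continuous_lt_right
    (fun d => expR (2 * d / c) * (`|k| * S + d * g) + d)).
    apply: cvgD; last exact: cvg_id.
    apply: cvgM.
      apply: (@continuous_comp _ _ _ (fun d : R => 2 * d / c));
        last exact: continuous_expR.
      by apply: cvgM; [apply: cvgM; [exact: cvg_cst|exact: cvg_id]|exact: cvg_cst].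
    by apply: cvgD; [exact: cvg_cst|apply: cvgM; [exact: cvg_id|exact: cvg_cst]].
  by rewrite mulr0 mul0r expR0 mul1r mul0r !addr0.
have small z : 0 < z < 1 ->
    (`|k| * sin (omega + theta) + d) * expR (2 * d / c) * I z
    < (p * omega ^+ 2 - a - d) * sin (omega * z + theta).
  move=> z01; have z01' : 0 <= z <= 1 by lra.
  have E0 := expR_gt0 (2 * d / c); have sz := sin_pos z z01'.
  have := dE; rewrite -ltrBrDr -(ltr_pM2r sz); apply: le_lt_trans.
  have -> : (`|k| * sin (omega + theta) + d) * expR (2 * d / c) * I z
    = expR (2 * d / c) * (`|k| * (sin (omega + theta) * I z) + d * I z) by ring.
  rewrite -[leRHS]mulrA ler_pM2l// mulrDl -!mulrA lerD//.
    by rewrite ler_wpM2l// SE.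
  by rewrite ler_pM2l// gE.
(* [L * A * expR (- d * t)] will bound the sum of the two barriers on the unit interval. *)
pose L := 1 + (`|k| + d) * expR (2 * d / c).
have L0 : 0 < L.
  by rewrite /L ltr_pwDl// mulr_ge0 ?expR_ge0// addr_ge0// ltW.
exists (L * (m^-1 + d^-1)), d; split => //.
  by rewrite mulr_gt0// addr_gt0// invr_gt0.
move=> u10 u20 Cu10 Cu20 _ _ _ u1 u2 [sol _] t t0.
set N := sup_norm u10 + sup_norm u20.
have n10 z : 0 <= z <= 1 -> `|u10 z| <= sup_norm u10 by exact: (le_sup_norm _ _ Cu10.1).
have n20 z : 0 <= z <= 1 -> `|u20 z| <= sup_norm u20 by exact: (le_sup_norm _ _ Cu20.1).
have z01 : 0 <= (0 : R) <= 1 by rewrite lexx ler01.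
have N10 := le_trans (normr_ge0 _) (n10 _ z01).
have N20 := le_trans (normr_ge0 _) (n20 _ z01).
have N0 : 0 <= N by rewrite addr_ge0.
(* The slack [e] keeps the initial bounds strict even when [N = 0]. The terms [m^-1] and [d^-1] in
   [A] ensure [N < A * m] for the first component and [N < d * A] for the second, where the gain is
   at least [d]. The share [e / L] costs at most [e] in the final estimate. *)
apply/ler_addgt0Pr => e e0.
pose A := (m^-1 + d^-1) * N + e / L.
have eL : 0 < e / L by rewrite divr_gt0.
have Am : N < A * m.
  have -> : A * m = N + (m / d * N + e / L * m).
    by rewrite /A; field; rewrite !gt_eqF.
  by rewrite ltrDl ltr_wpDl ?(mulr_gt0 eL)// mulr_ge0// ltW// divr_gt0.
have Ad : N < d * A.
  have -> : d * A = N + (d / m * N + e / L * d).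
    by rewrite /A; field; rewrite !gt_eqF.
  by rewrite ltrDl ltr_wpDl ?(mulr_gt0 eL)// mulr_ge0// ltW// divr_gt0.
have A0 : 0 < A by rewrite -(pmulr_rgt0 _ d0); exact: le_lt_trans Ad.
have sk : `|k| * sin (omega + theta) <= `|k| by rewrite ler_piMr// sin_le1.
have k0 : 0 <= `|k| * sin (omega + theta) by rewrite mulr_ge0// ltW.
have bound z : 0 <= z <= 1 -> `|u1 t z| <= A * expR (- d * t) /\
    `|u2 t z| <= (`|k| + d) * A * (expR (2 * d / c) * expR (- d * t)).
  move=> z01'; have [||h1 h2] := barrier_bound p c a k q b u10 u20 u1 u2 A d omega theta
    hp hc A0 d0 sol cb sin_pos robin small _ _ t z t0 z01'.
  - move=> y y01; apply: (le_lt_trans (n10 y y01)).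
    apply: (@le_lt_trans _ _ N); first by rewrite lerDl.
    by apply: (lt_le_trans Am); rewrite ler_pM2l// mE.
  - move=> y y01; apply: (le_lt_trans (n20 y y01)).
    apply: (@le_lt_trans _ _ N); first by rewrite lerDr.
    by apply: (lt_le_trans Ad); rewrite ler_pM2r// lerDr.
  split; first by apply: (le_trans (ltW h1)); rewrite ler_piMr ?sin_le1// mulr_ge0 ?expR_ge0// ltW.
  apply: (le_trans (ltW h2)); rewrite /barrier2 -expRD.
  apply: ler_pM; rewrite ?expR_ge0 ?ler_pM2r ?lerD2r//.
    by rewrite mulr_ge0 ?(ltW A0)// addr_ge0// ltW.
  rewrite ler_expR mulNr lerD2r ger_pMr ?divr_gt0 ?mulr_gt0//.
  by case/andP: z01'.
have E0 := expR_gt0 (- d * t).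
have E1 : expR (- d * t) <= 1.
  by rewrite -[leRHS]expR0 ler_expR mulNr oppr_le0 mulr_ge0// ltW.
have b1' := sup_norm_le (u1 t) _ (fun z zI => (bound z zI).1).
have b2' := sup_norm_le (u2 t) _ (fun z zI => (bound z zI).2).
apply: (le_trans (lerD b1' b2')).
have -> : A * expR (- d * t) + (`|k| + d) * A * (expR (2 * d / c) * expR (- d * t))
    = L * A * expR (- d * t) by rewrite /L; ring.
have -> : L * A * expR (- d * t)
    = L * (m^-1 + d^-1) * expR (- d * t) * N + e * expR (- d * t).
  by rewrite /A; field; rewrite !gt_eqF.
by rewrite lerD2l ler_piMr// ltW.
Qed.
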